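(* The following sixteen mesh patterns $(12,R)$ are pairwise equidistributed, where $R$ ranges over: $\{(0,2),(1,2),(2,2),(0,1),(2,1)\}$, $\{(0,2),(1,2),(0,1),(0,0),(1,0)\}$, $\{(1,2),(2,2),(2,1),(1,0),(2,0)\}$, $\{(0,1),(2,1),(0,0),(1,0),(2,0)\}$, $\{(0,2),(1,2),(2,2),(1,1),(2,1)\}$, $\{(0,2),(0,1),(1,1),(0,0),(1,0)\}$, $\{(1,2),(2,2),(1,1),(2,1),(2,0)\}$, $\{(0,1),(1,1),(0,0),(1,0),(2,0)\}$, $\{(0,2),(2,2),(0,1),(2,1),(2,0)\}$, $\{(0,2),(0,1),(2,1),(0,0),(2,0)\}$, $\{(0,2),(1,2),(2,2),(1,0),(2,0)\}$, $\{(0,2),(1,2),(0,0),(1,0),(2,0)\}$, $\{(0,2),(1,2),(2,2),(0,0),(2,0)\}$, $\{(0,2),(2,2),(0,1),(0,0),(2,0)\}$, $\{(0,2),(2,2),(2,1),(0,0),(2,0)\}$, $\{(0,2),(2,2),(0,0),(1,0),(2,0)\}$. Moreover, for each such pattern $p$ and each $n\ge2$, exactly $n!/2$ permutations in $S_n$ avoid $p$.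
   Context: For $R\subseteq\{0,1,2\}^2$ and $\pi=\pi_1\cdots\pi_n\in S_n$, an occurrence of the mesh pattern $(12,R)$ in $\pi$ is a pair of positions $i_1<i_2$ with $\pi_{i_1}<\pi_{i_2}$ such that, setting $x_0=0,x_1=i_1,x_2=i_2,x_3=n+1$ and $y_0=0,y_1=\pi_{i_1},y_2=\pi_{i_2},y_3=n+1$, for every $(a,b)\in R$ there is no index $k$ with $x_a<k<x_{a+1}$ and $y_b<\pi_k<y_{b+1}$. A permutation avoids $p$ if it has no occurrence of $p$. $s_{n,k}(p)$ is the number of $\pi\in S_n$ with exactly $k$ occurrences of $p$; $p_1,p_2$ are equidistributed if $s_{n,k}(p_1)=s_{n,k}(p_2)$ for all $n,k\ge 0$. *)

(* Defs.v *)
From mathcomp Require Import all_boot all_fingroup.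

Set Implicit Arguments.
Unset Strict Implicit.
Unset Printing Implicit Defensive.

(* The mesh pattern (12, R) is represented by its shading R.  A cell (a, b) has
   horizontal index a and vertical index b, as in the usual plot of a
   permutation. *)
Definition shading := {set 'I_3 * 'I_3}.

Definition shading_of (cells : seq (nat * nat)) : shading :=
  [set c | (val c.1, val c.2) \in cells].

(* Positions and values in 'S_n start at 0; the successors below shift them to
   the range 1, ..., n, so that 0 and n.+1 are the outer grid lines. *)
Definition xlines n (i j : 'I_n) : seq nat := [:: 0; i.+1; j.+1; n.+1].
Definition ylines n (s : 'S_n) (i j : 'I_n) : seq nat :=
  [:: 0; (s i).+1; (s j).+1; n.+1].

Definition in_cell n (s : 'S_n) (i j : 'I_n) (c : 'I_3 * 'I_3) (k : 'I_n) : bool :=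
  let x := nth 0 (xlines i j) in
  let y := nth 0 (ylines s i j) in
  (x c.1 < k.+1 < x c.1.+1) && (y c.2 < (s k).+1 < y c.2.+1).

Definition occurrence (R : shading) n (s : 'S_n) (ij : 'I_n * 'I_n) : bool :=
  let: (i, j) := ij in
  [&& i < j, s i < s j & [forall c in R, ~~ [exists k, in_cell s i j c k]]].

Definition occ_count (R : shading) n (s : 'S_n) : nat :=
  #|[set ij | occurrence R s ij]|.

Definition avoids (R : shading) n (s : 'S_n) : bool :=
  ~~ [exists ij, occurrence R s ij].

Definition num_perms_with_occ (R : shading) (n k : nat) : nat :=
  #|[set s : 'S_n | occ_count R s == k]|.

Definition equidistributed (R1 R2 : shading) : Prop :=
  forall n k, num_perms_with_occ R1 n k = num_perms_with_occ R2 n k.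

Definition sixteen_shadings : seq shading := map shading_of
  [:: [:: (0,2); (1,2); (2,2); (0,1); (2,1)];
      [:: (0,2); (1,2); (0,1); (0,0); (1,0)];
      [:: (1,2); (2,2); (2,1); (1,0); (2,0)];
      [:: (0,1); (2,1); (0,0); (1,0); (2,0)];
      [:: (0,2); (1,2); (2,2); (1,1); (2,1)];
      [:: (0,2); (0,1); (1,1); (0,0); (1,0)];
      [:: (1,2); (2,2); (1,1); (2,1); (2,0)];
      [:: (0,1); (1,1); (0,0); (1,0); (2,0)];
      [:: (0,2); (2,2); (0,1); (2,1); (2,0)];
      [:: (0,2); (0,1); (2,1); (0,0); (2,0)];
      [:: (0,2); (1,2); (2,2); (1,0); (2,0)];
      [:: (0,2); (1,2); (0,0); (1,0); (2,0)];
      [:: (0,2); (1,2); (2,2); (0,0); (2,0)];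
      [:: (0,2); (2,2); (0,1); (0,0); (2,0)];
      [:: (0,2); (2,2); (2,1); (0,0); (2,0)];
      [:: (0,2); (2,2); (0,0); (1,0); (2,0)]].

(* Main.v *)
Require Import Defs.
From mathcomp Require Import all_boot all_fingroup.
From mathcomp Require Import all_algebra zify ring.

(** Inverse and reverse-complement split the sixteen patterns into four orbits.
    For one pattern of each orbit, follow the number of occurrences while an
    entry is inserted into a permutation of size n + 1: the smallest one, or,
    for [pattern13], the second largest one.

    - For [pattern1], [pattern5] and [pattern13], an occurrence is gained at
      exactly one position, and only while the maximum is in last place;
      inserting in last place destroys this property for good.
    - For [pattern9], an occurrence is gained in first place, and all
      occurrences are lost in last place.

    Both processes lead to the same distribution F(q) on size n + 1:
      (q - 2) F(q) = (q - 1) q (q + 1) ... (q + n - 1) - (n + 1)!,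
    and q = 0 gives F(0) = (n + 1)! / 2 as soon as n > 0. *)

Set Implicit Arguments.
Unset Strict Implicit.
Unset Printing Implicit Defensive.
Import GRing.Theory Num.Theory.

(** * Occurrences in coordinates and their generating polynomial *)

(** Column or row [a] of the mesh, with the outer grid lines left implicit. Every index from 2 up is
    read as the last one; [in_grid] restricts to genuine cells. *)
Definition slot (i j a k : nat) : bool :=
  match a with 0 => k < i | 1 => i < k < j | _ => j < k end.

Definition hits n (s : 'S_n) (i j k : 'I_n) (c : nat * nat) : bool :=
  slot i j c.1 k && slot (s i) (s j) c.2 (s k).

Definition occ (l : seq (nat * nat)) n (s : 'S_n) (i j : 'I_n) : bool :=
  [&& i < j, s i < s j & [forall k, ~~ has (hits s i j k) l]].

Definition in_grid (l : seq (nat * nat)) : bool :=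
  all (fun c => (c.1 < 3) && (c.2 < 3)) l.

Lemma in_cellE n (s : 'S_n) (i j : 'I_n) (c : 'I_3 * 'I_3) k :
  in_cell s i j c k = hits s i j k (val c.1, val c.2).
Proof.
case: c => -[[|[|[|a]]] ha] [[|[|[|b]]] hb] //=;
  by rewrite /in_cell /hits /= ?ltnS ?leq0n ?ltn_ord ?andbT.
Qed.

Lemma occurrenceE l n (s : 'S_n) (i j : 'I_n) :
  in_grid l -> occurrence (shading_of l) s (i, j) = occ l s i j.
Proof.
move=> /allP hl; rewrite /occurrence /occ; congr [&& _, _ & _].
apply/forall_inP/forallP => h x.
  apply/hasPn => -[a b] hc; have /andP[/= ha hb] := hl _ hc.
  have := h (Ordinal ha, Ordinal hb); rewrite inE /= => /(_ hc).
  by move=> /existsPn /(_ x); rewrite in_cellE.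
rewrite inE => hx; apply/existsPn => k; rewrite in_cellE.
by have /hasPn := h k; apply.
Qed.

Lemma occ_countE l n (s : 'S_n) :
  in_grid l -> occ_count (shading_of l) s = \sum_i \sum_j occ l s i j.
Proof.
move=> hl; rewrite /occ_count -sum1_card pair_big /= big_mkcond /=.
by apply: eq_bigr => -[i j] _; rewrite inE occurrenceE //=; case: occ.
Qed.

Lemma shading_of_perm_eq l1 l2 : perm_eq l1 l2 -> shading_of l1 = shading_of l2.
Proof. by move=> h; apply/setP => c; rewrite !inE (perm_mem h). Qed.

Local Open Scope ring_scope.

(** The polynomial F of the outline, with integer coefficients so that subtraction and cancellation
    are available. *)
Definition occ_poly (l : seq (nat * nat)) n : {poly int} :=
  \sum_(s : 'S_n) 'X^(occ_count (shading_of l) s).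

Lemma coef_occ_poly l n k :
  (occ_poly l n)`_k = (num_perms_with_occ (shading_of l) n k)%:R.
Proof.
rewrite /occ_poly coef_sum /num_perms_with_occ -sum1_card natr_sum.
rewrite [RHS]big_mkcond /=; apply: eq_bigr => s _.
by rewrite coefXn inE eq_sym; case: eqP.
Qed.

Local Close Scope ring_scope.

(** * Symmetries: inverse and reverse-complement *)

Definition swap_cell (c : nat * nat) := (c.2, c.1).
Definition rot_cell (c : nat * nat) := (2 - c.1, 2 - c.2).

(** Inversion reflects the plot in its diagonal: positions and values trade roles, and so do the
    coordinates of each cell. *)
Lemma occ_swap l n (s : 'S_n) i j :
  occ (map swap_cell l) s^-1%g (s i) (s j) = occ l s i j.
Proof.
rewrite /occ !permK andbCA; congr [&& _, _ & _].
apply/forallP/forallP => h k; [have := h (s k) | have := h (s^-1%g k)];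
  rewrite has_map; apply: contra; apply: sub_has => c;
  by rewrite /hits /= !permK ?permKV andbC.
Qed.

Definition rot_perm n (s : 'S_n) : 'S_n :=
  (perm (@rev_ord_inj n) * s * perm (@rev_ord_inj n))%g.

Lemma rot_permE n (s : 'S_n) i : rot_perm s i = rev_ord (s (rev_ord i)).
Proof. by rewrite /rot_perm !permM !permE. Qed.

Lemma rot_permK n : involutive (@rot_perm n).
Proof. by move=> s; apply/permP => i; rewrite !rot_permE !rev_ordK. Qed.

Lemma slot_rev n (i j k : 'I_n) a : a < 3 ->
  slot (rev_ord j) (rev_ord i) (2 - a) (rev_ord k) = slot i j a k.
Proof.
by case: a => [|[|[|//]]] _ /=;
  have := ltn_ord i; have := ltn_ord j; have := ltn_ord k; lia.
Qed.

(** A half-turn of the plot reverses both orders, so the two ends of an occurrence are exchanged. *)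
Lemma occ_rot l n (s : 'S_n) i j : in_grid l ->
  occ (map rot_cell l) (rot_perm s) (rev_ord j) (rev_ord i) = occ l s i j.
Proof.
move=> /allP hl; rewrite /occ !rot_permE !rev_ordK.
congr [&& _, _ & _]; first by have := ltn_ord i; have := ltn_ord j => /=; lia.
  by have := ltn_ord (s i); have := ltn_ord (s j) => /=; lia.
have hE k c : c \in l ->
  hits (rot_perm s) (rev_ord j) (rev_ord i) (rev_ord k) (rot_cell c)
  = hits s i j k c.
  by move=> /hl/andP[h1 h2]; rewrite /hits !rot_permE !rev_ordK !slot_rev.
apply/forallP/forallP => h k; [have := h (rev_ord k) | have := h (rev_ord k)];
  rewrite has_map; apply: contra => /hasP[c hc] hit; apply/hasP; exists c => //=.
  by rewrite hE.
by rewrite -hE ?rev_ordK.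
Qed.

Lemma in_grid_swap l : in_grid l -> in_grid (map swap_cell l).
Proof. by rewrite /in_grid all_map; apply: sub_all => c /=; rewrite andbC. Qed.

Lemma in_grid_rot l : in_grid (map rot_cell l).
Proof. by rewrite /in_grid all_map; apply/allP => c _ /=; lia. Qed.

Lemma occ_poly_swap l n : in_grid l -> occ_poly (map swap_cell l) n = occ_poly l n.
Proof.
move=> hl; rewrite /occ_poly (reindex_inj invg_inj) /=.
apply: eq_bigr => s _; rewrite !occ_countE ?in_grid_swap //.
rewrite (reindex_inj (@perm_inj _ s)) /=; congr ('X^_)%R.
apply: eq_bigr => i _; rewrite (reindex_inj (@perm_inj _ s)) /=.
by apply: eq_bigr => j _; rewrite occ_swap.
Qed.

Lemma occ_poly_rot l n : in_grid l -> occ_poly (map rot_cell l) n = occ_poly l n.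
Proof.
move=> hl; rewrite /occ_poly (reindex_inj (inv_inj (@rot_permK n))) /=.
apply: eq_bigr => s _; rewrite !occ_countE ?in_grid_rot //.
rewrite exchange_big (reindex_inj rev_ord_inj) /=; congr ('X^_)%R.
apply: eq_bigr => i _; rewrite (reindex_inj rev_ord_inj) /=.
by apply: eq_bigr => j _; rewrite occ_rot.
Qed.

(** * Insertion of an entry *)

Lemma lift_perm_inj n (v : 'I_n.+1) :
  injective (fun x : 'I_n.+1 * 'S_n => lift_perm x.1 v x.2).
Proof.
move=> [p s] [q t] /= e.
have epq : p = q.
  by apply: (@perm_inj _ (lift_perm p v s)); rewrite {2}e !lift_perm_id.
rewrite -{q}epq in e *; congr pair; apply/permP => k.
by apply: (@lift_inj _ v); rewrite -!(lift_perm_lift p) e.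
Qed.

(** For a fixed value [v], insertion is injective, and both sides have (n + 1)! elements, so each
    permutation arises exactly once. *)
Lemma sum_lift_perm (V : nmodType) n (v : 'I_n.+1) (G : 'S_n.+1 -> V) :
  (\sum_s G s = \sum_(s : 'S_n) \sum_p G (lift_perm p v s))%R.
Proof.
rewrite exchange_big pair_bigA /= (reindex (fun x => lift_perm x.1 v x.2)) //=.
apply/onW_bij/inj_card_bij; first exact: lift_perm_inj.
by rewrite card_prod !card_Sn card_ord factS.
Qed.

Lemma ltn_lift n (p : 'I_n.+1) (i j : 'I_n) : (lift p i < lift p j) = (i < j).
Proof. by rewrite /= /bump; lia. Qed.

Lemma slot_lift n (p : 'I_n.+1) (i j k : 'I_n) a :
  slot (lift p i) (lift p j) a (lift p k) = slot i j a k.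
Proof. by case: a => [|[|a]]; rewrite /slot !ltn_lift. Qed.

(** Insertion keeps the relative order of the old entries, so only the new entry can spoil an old
    occurrence. *)
Lemma occ_lift l n (s : 'S_n) (p v : 'I_n.+1) i j (t := lift_perm p v s) :
  occ l t (lift p i) (lift p j)
  = occ l s i j && ~~ has (hits t (lift p i) (lift p j) p) l.
Proof.
rewrite /occ {1 2}/t !lift_perm_lift !ltn_lift -!andbA.
congr [&& _, _ & _].
have hE k : hits t (lift p i) (lift p j) (lift p k) =1 hits s i j k.
  by move=> c; rewrite /hits /t !lift_perm_lift !slot_lift.
apply/forallP/andP => [h|[/forallP h hp] k]; last first.
  by case: (unliftP p k) => [k' ->|-> //]; rewrite (eq_has (hE k')).
by split=> //; apply/forallP => k; rewrite -(eq_has (hE k)).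
Qed.

Lemma occ_count_lift l n (s : 'S_n) (p v : 'I_n.+1) (t := lift_perm p v s) :
  in_grid l ->
  occ_count (shading_of l) t = \sum_j occ l t p j + \sum_i occ l t (lift p i) p
    + \sum_i \sum_j occ l t (lift p i) (lift p j).
Proof.
move=> hl; rewrite occ_countE // (bigD1_ord p) //= -addnA -big_split /=.
by congr (_ + _)%N; apply: eq_bigr => i _; rewrite (bigD1_ord p).
Qed.

(** * The maximum in last place *)

Definition top_last n (s : 'S_n.+1) : bool := s ord_max == ord_max.

Lemma lift_ord_max n (p : 'I_n.+2) : p != ord_max -> lift p ord_max = ord_max.
Proof.
rewrite -val_eqE /= => hp; apply: val_inj; rewrite /= /bump.
by have := ltn_ord p; lia.
Qed.

Lemma top_last_lift n (p v : 'I_n.+2) (s : 'S_n.+1) : v != ord_max ->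
  top_last (lift_perm p v s) = (p != ord_max) && top_last s.
Proof.
move=> hv; rewrite /top_last.
have [->|hp] := eqVneq p ord_max; first by rewrite lift_perm_id (negPf hv).
rewrite -{1}(lift_ord_max hp) lift_perm_lift -(lift_ord_max hv).
by rewrite (inj_eq lift_inj).
Qed.

(** * Occurrences in the four representatives *)

Lemma perm_eq_val n (s : 'S_n) (i j : 'I_n) :
  ((s i : nat) == s j) = ((i : nat) == j).
Proof. by rewrite !val_eqE (inj_eq perm_inj). Qed.

(* The numbers are the positions in [sixteen_shadings], counted from 1. *)
Definition pattern1 := [:: (0,2); (1,2); (2,2); (0,1); (2,1)].
Definition pattern5 := [:: (0,2); (1,2); (2,2); (1,1); (2,1)].
Definition pattern9 := [:: (0,2); (2,2); (0,1); (2,1); (2,0)].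
Definition pattern13 := [:: (0,2); (1,2); (2,2); (0,0); (2,0)].

(** With the whole top row shaded, a maximum other than the upper entry would lie in one of its
    three cells. *)
Lemma occ_top l n (s : 'S_n.+1) i j :
  all (mem l) [:: (0,2); (1,2); (2,2)] -> occ l s i j -> s j = ord_max.
Proof.
move=> /and4P[h0 h1 h2 _] /and3P[hij hs /forallP /(_ (s^-1%g ord_max)) h].
apply: val_inj => /=; apply/eqP; rewrite eqn_leq -ltnS ltn_ord leqNgt.
apply/negP => hj; have hjN : s^-1%g ord_max != j.
  by apply: contraTneq hj => <-; rewrite permKV ltnn.
have hiN : s^-1%g ord_max != i.
  by apply: contraTneq hs => <-; rewrite permKV -leqNgt -ltnS ltn_ord.
case/hasP: h; move: hjN hiN; set m := s^-1%g _; rewrite -!val_eqE => hjN hiN.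
have top x : (x, 2) \in l -> slot i j x m -> exists2 c, c \in l & hits s i j m c.
  by move=> hx hm; exists (x, 2); rewrite // /hits hm /= permKV.
by case: (ltngtP m i) hiN => // hmi _; [apply: (top 0)|];
  case: (ltngtP m j) hjN => // hmj _; [apply: (top 1)|apply: (top 2)] => //=; lia.
Qed.

Lemma occ_no_hit l n (s : 'S_n) i j k c :
  c \in l -> occ l s i j -> ~~ hits s i j k c.
Proof. by move=> hc /and3P[_ _ /forallP /(_ k) /hasPn]; apply. Qed.

(** Otherwise the last entry lies strictly between the minimum and the maximum in value, hence in
    cell [(2,1)]. *)
Lemma occ_min_max_last l n (t : 'S_n.+1) i j : (2,1) \in l ->
  occ l t i j -> t i = ord0 -> t j = ord_max -> j = ord_max.
Proof.
move=> hl h ti tj; have := occ_no_hit ord_max hl h; case/and3P: h => hij _ _.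
have := (perm_eq_val t ord_max i, perm_eq_val t ord_max j).
rewrite /hits /= ti tj /= => -[h1 h2] h3; apply: val_inj => /=.
have := ltn_ord (t ord_max); have := ltn_ord j; lia.
Qed.

(** The top row and [(2,1)] put the maximum at [j] in last place; then [(0,1)] excludes any entry
    before the minimum. Conversely all other entries fall in [(1,1)]. The condition [p != j] matters
    in size 1. *)
Lemma occ_pattern1 n (t : 'S_n.+1) p j : t p = ord0 ->
  occ pattern1 t p j = [&& p == ord0, j == ord_max, p != j & top_last t].
Proof.
move=> tp; apply/idP/and4P => [h|[/eqP hp /eqP hj hpj /eqP hm]].
  have tj := occ_top (l := pattern1) isT h.
  have ej : j = ord_max by apply: occ_min_max_last h tp tj.
  have hj : p < j by case/and3P: h.
  have := occ_no_hit ord0 (isT : (0, 1) \in pattern1) h.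
  have := (perm_eq_val t ord0 p, perm_eq_val t ord0 j, ltn_ord (t ord0)).
  rewrite /top_last ej in tj hj *; rewrite /hits tp tj eqxx -!val_eqE /=.
  by move=> [[h1 h2] h3] h4; simpl in *; clear h; split=> //; lia.
subst p j; apply/and3P; split; rewrite ?tp ?hm.
- by rewrite /= lt0n; move: hpj; rewrite -val_eqE /= eq_sym.
- by rewrite /= lt0n; move: hpj; rewrite -val_eqE /= eq_sym.
apply/forallP => k; rewrite /hits /= tp hm /=.
have := ltn_ord k; have := ltn_ord (t k); lia.
Qed.

(** Here [(1,1)] excludes any entry between the minimum and the last place, so the minimum is at
    [z], the last position but one. *)
Lemma occ_pattern5 n (t : 'S_n.+2) (z p j : 'I_n.+2) : z = n :> nat -> t p = ord0 ->
  occ pattern5 t p j = [&& p == z, j == ord_max & top_last t].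
Proof.
move=> hz tp; apply/idP/and3P => [h|[/eqP hp /eqP hj /eqP hm]].
  have tj := occ_top (l := pattern5) isT h.
  have ej : j = ord_max by apply: occ_min_max_last h tp tj.
  have hj : p < j by case/and3P: h.
  have := occ_no_hit z (isT : (1, 1) \in pattern5) h.
  have := (perm_eq_val t z p, perm_eq_val t z j, ltn_ord (t z)).
  rewrite /top_last ej in tj hj *; rewrite /hits tp tj eqxx -!val_eqE /= hz.
  by move=> [[h1 h2] h3] h4; simpl in *; clear h; split=> //; lia.
subst p j; apply/and3P; split; rewrite ?tp ?hm ?hz //=.
apply/forallP => k; rewrite /hits /= tp hm hz /=.
have := ltn_ord k; have := ltn_ord (t k); lia.
Qed.

(** The whole right column is shaded, so nothing can follow [j]. *)
Lemma occ_pattern9_last n (s : 'S_n.+1) i j : occ pattern9 s i j -> j = ord_max.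
Proof.
move=> h; have [/= hij hs _] := and3P h.
have := occ_no_hit ord_max (isT : (2, 0) \in pattern9) h.
have := occ_no_hit ord_max (isT : (2, 1) \in pattern9) h.
have := occ_no_hit ord_max (isT : (2, 2) \in pattern9) h.
have := (perm_eq_val s ord_max i, perm_eq_val s ord_max j, ltn_ord j).
rewrite /hits /= => -[[h1 h2] h3] h4 h5 h6; apply: val_inj => /=; clear h; lia.
Qed.

(** Entries before the minimum would lie in [(0,1)] or [(0,2)]. Once the ends are first and last,
    all other entries are in the unshaded middle column. *)
Lemma occ_pattern9 n (t : 'S_n.+1) p j : t p = ord0 ->
  occ pattern9 t p j = [&& p == ord0, j == ord_max & p != j].
Proof.
move=> tp; apply/idP/and3P => [h|[/eqP hp /eqP hj hpj]].
  have ej := occ_pattern9_last h.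
  have hj : p < j by case/and3P: h.
  have := occ_no_hit ord0 (isT : (0, 1) \in pattern9) h.
  have := occ_no_hit ord0 (isT : (0, 2) \in pattern9) h.
  have := (perm_eq_val t ord0 p, perm_eq_val t ord0 j).
  rewrite ej in hj *; rewrite /hits tp -!val_eqE /=.
  by move=> [h1 h2] h3 h4; simpl in *; clear h; split=> //; lia.
subst p j; have hn : 0 < n by move: hpj; rewrite -val_eqE /=; lia.
apply/and3P; split; rewrite ?tp //=.
  by have := perm_eq_val t ord_max ord0; rewrite tp /=; lia.
apply/forallP => k; rewrite /hits /= tp /=.
have := ltn_ord k; lia.
Qed.

(** The value [v] is the second largest, so all entries but the two ends lie in the bottom row,
    where [(0,0)] and [(2,0)] force them between the ends. *)
Lemma occ_pattern13 n (t : 'S_n.+2) (v p j : 'I_n.+2) : v = n :> nat -> t p = v ->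
  occ pattern13 t p j = [&& p == ord0, j == ord_max & top_last t].
Proof.
move=> hv tp; apply/idP/and3P => [h|[/eqP hp /eqP hj /eqP hm]].
  have tj := occ_top (l := pattern13) isT h.
  have hj : p < j by case/and3P: h.
  have := occ_no_hit ord0 (isT : (0, 0) \in pattern13) h.
  have := occ_no_hit ord_max (isT : (2, 0) \in pattern13) h.
  have := (perm_eq_val t ord0 p, perm_eq_val t ord0 j, ltn_ord (t ord0)).
  have := (perm_eq_val t ord_max p, perm_eq_val t ord_max j,
           ltn_ord (t ord_max), ltn_ord j).
  rewrite /top_last /hits tp tj -!val_eqE /= hv.
  move=> [[[a1 a2] a3] a4] [[b1 b2] b3] a5 b5; clear h.
  have ep : p = 0 :> nat by clear a1 a2 a3 a5; lia.
  have ej : j = n.+1 :> nat by clear b1 b2 b3 b5; lia.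
  by rewrite ep ej; split=> //; clear b1 b2 b3 b5; lia.
subst p j; apply/and3P; split; rewrite ?tp ?hm ?hv //=.
apply/forallP => k; rewrite /hits /= tp hm hv /=.
have := ltn_ord k; have := ltn_ord (t k); have := perm_eq_val t k ord0.
rewrite tp hv /=; lia.
Qed.

Lemma inserted_min_misses l n (t : 'S_n) i j k : 0 = t k :> nat ->
  all (fun c => c.2 != 0) l -> ~~ has (hits t i j k) l.
Proof.
move=> tk /allP hl; apply/hasPn => -[a b] /hl /=.
by rewrite /hits -tk; case: b => [|[|b]] //= _; rewrite ?ltn0 ?andbF.
Qed.

Lemma occ_min_right l n (t : 'S_n) i p : 0 = t p :> nat -> occ l t i p = false.
Proof. by move=> h; rewrite /occ -h ltn0 andbF. Qed.

(** * Effect of an insertion on the number of occurrences *)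

(** The first process of the outline: [v] is the inserted value and [z] the only gaining
    position. *)
Definition top_insertion l n (v z : 'I_n.+2) : Prop :=
  forall (s : 'S_n.+1) p, occ_count (shading_of l) (lift_perm p v s)
    = occ_count (shading_of l) s + ((p == z) && top_last s).

Lemma top_insertionI l n (v z : 'I_n.+2) : in_grid l ->
  v != ord_max -> z != ord_max ->
  (forall (s : 'S_n.+2) p j, s p = v ->
     occ l s p j = [&& p == z, j == ord_max & top_last s]) ->
  (forall (s : 'S_n.+2) p i, s p = v -> ~~ occ l s i p) ->
  (forall (s : 'S_n.+1) p i j, occ l s i j ->
     ~~ has (hits (lift_perm p v s) (lift p i) (lift p j) p) l) ->
  top_insertion l v z.
Proof.
move=> hl hv hz hrow hcol hold s p; rewrite occ_count_lift //.
rewrite [X in _ + X + _]big1 => [|i _]; last first.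
  by rewrite (negPf (hcol _ _ _ _)) // lift_perm_id.
rewrite addn0 addnC occ_countE //; congr (_ + _).
  apply: eq_bigr => i _; apply: eq_bigr => j _; rewrite occ_lift.
  by case ho: occ => //; rewrite hold.
under eq_bigr => j _ do rewrite hrow ?lift_perm_id // top_last_lift //.
have [->|_] := eqVneq p z; last by rewrite big1.
by rewrite (bigD1 ord_max) //= eqxx hz /= big1 ?addn0 // => j /negPf ->.
Qed.

Lemma top_insertion_pattern1 n : @top_insertion pattern1 n ord0 ord0.
Proof.
apply: top_insertionI => //.
- move=> s p j hp; rewrite occ_pattern1 //.
  by case: eqP => //= ->; case: eqP => //= ->.
- by move=> s p i hp; rewrite occ_min_right // hp.
- by move=> s p i j _; apply: inserted_min_misses; rewrite ?lift_perm_id.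
Qed.

Lemma top_insertion_pattern5 n : @top_insertion pattern5 n ord0 (inord n).
Proof.
apply: top_insertionI => //.
- by rewrite -val_eqE /= inordK //; lia.
- by move=> s p j hp; rewrite (occ_pattern5 _ (inordK _)).
- by move=> s p i hp; rewrite occ_min_right // hp.
- by move=> s p i j _; apply: inserted_min_misses; rewrite ?lift_perm_id.
Qed.

Lemma top_insertion_pattern13 n : @top_insertion pattern13 n (inord n) ord0.
Proof.
have hv : inord n != ord_max :> 'I_n.+2 by rewrite -val_eqE /= inordK //; lia.
apply: top_insertionI => //.
- by move=> s p j hp; rewrite (occ_pattern13 _ (inordK _) hp).
- move=> s p i hp; apply/negP => /(@occ_top pattern13 _ _ _ _ isT); rewrite hp => h.
  by rewrite h eqxx in hv.
(* The old upper entry is the maximum, so the inserted second largest value falls in the middle row,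
   where [pattern13] has no shaded cell. *)
move=> s p i j h; have := @occ_top pattern13 _ _ _ _ isT h.
case/and3P: h => _ + _.
rewrite /hits /= !lift_perm_lift lift_perm_id /= inordK // /bump => + hj.
by rewrite hj /=; lia.
Qed.

Lemma occ_count_pattern9_insert n (s : 'S_n.+1) (p : 'I_n.+2) :
  occ_count (shading_of pattern9) (lift_perm p ord0 s)
  = if p == ord_max then 0 else occ_count (shading_of pattern9) s + (p == ord0).
Proof.
rewrite occ_count_lift //.
rewrite [X in _ + X + _]big1 => [|i _]; last first.
  by rewrite occ_min_right // lift_perm_id.
rewrite addn0.
under eq_bigr => j _ do rewrite occ_pattern9 ?lift_perm_id //.
have [->|hp] := eqVneq p ord_max.
  (* An occurrence must end in last place, now taken by the minimum. *)
  rewrite big1 // big1 // => i _; rewrite big1 // => j _.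
  apply/eqP; rewrite eqb0; apply: contraTN isT => /occ_pattern9_last/eqP.
  by rewrite eq_sym (negPf (neq_lift _ _)).
rewrite addnC occ_countE //; congr (_ + _).
  apply: eq_bigr => i _; apply: eq_bigr => j _; rewrite occ_lift.
  (* The old occurrence ends to the right of the inserted minimum, and in the bottom row only
     [(2,0)] is shaded. *)
  case ho: occ => //=; rewrite (occ_pattern9_last ho) lift_ord_max //.
  apply/eqP; rewrite eqb1 /hits /= lift_perm_id /=.
  by have := ltn_ord p; lia.
rewrite (bigD1 ord_max) //= eqxx hp !andbT big1 ?addn0 // => j /negPf ->.
by rewrite andbF.
Qed.

(** * Recurrences and the closed form *)

Local Open Scope ring_scope.

Definition occ_formula n : {poly int} :=
  ('X - 1) * \prod_(k < n) ('X + k%:R) - (n.+1)`!%:R.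

Lemma occ_poly1 l : in_grid l -> occ_poly l 1 = 1.
Proof.
move=> hl; rewrite /occ_poly.
have h (s : 'S_1) : occ_count (shading_of l) s = 0.
  rewrite occ_countE // big1 // => i _; rewrite big1 // => j _.
  by rewrite /occ !ord1.
under eq_bigr => s _ do rewrite h.
by rewrite sumr_const card_Sn.
Qed.

Lemma card_neq2 n (x y : 'I_n.+2) :
  x != y -> #|[pred p | (p != x) && (p != y)]| = n.
Proof.
move=> hxy; have := cardC (pred2 x y); rewrite card2 hxy card_ord => -[] h.
by rewrite -[RHS]h; apply: eq_card => p; rewrite !inE negb_or.
Qed.

Lemma occ_poly_top l (v z : forall n, 'I_n.+2) n : in_grid l ->
  (forall m, v m != ord_max) -> (forall m, z m != ord_max) ->
  (forall m, top_insertion l (v m) (z m)) ->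
  ('X - 2%:R) * occ_poly l n.+1 = occ_formula n.
Proof.
move=> hl hv hz hins.
(* [A] restricts the generating polynomial to permutations with the maximum last. *)
pose A m : {poly int} := \sum_(s : 'S_m.+1)
  (if top_last s then 'X^(occ_count (shading_of l) s) else 0).
have hA m : A m = \prod_(k < m) ('X + k%:R).
  elim: m => [|m IH].
    rewrite big_ord0 -(occ_poly1 hl); apply: eq_bigr => s _.
    by rewrite /top_last !ord1 eqxx.
  rewrite big_ord_recr -IH /= /A (sum_lift_perm (v m)) mulr_suml.
  apply: eq_bigr => s _.
  under eq_bigr => p _ do rewrite top_last_lift // hins.
  case: (top_last s); last by rewrite mul0r big1 // => p _; rewrite andbF.
  (* Last place leaves the class, [z m] gives a factor ['X], and each of the other [m] positions a
     factor 1. *)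
  rewrite (bigD1 ord_max) //= eqxx /= add0r (bigD1 (z m)) /= ?hz // eqxx /=.
  rewrite addn1 exprSr mulrDr; congr (_ + _).
  under eq_bigr => p /andP[h1 h2] do rewrite h1 (negPf h2) /= addn0.
  rewrite sumr_const mulr_natr; congr (_ *+ _).
  by rewrite -[RHS](@card_neq2 m ord_max (z m)) 1?eq_sym.
(* All [m.+2] positions keep the count, up to the correction ['X - 1] at [z m] when the maximum is
   last. *)
have hF m : occ_poly l m.+2 = m.+2%:R * occ_poly l m.+1 + ('X - 1) * A m.
  rewrite /occ_poly (sum_lift_perm (v m)) mulr_sumr mulr_sumr -big_split.
  apply: eq_bigr => s _ /=.
  under eq_bigr => p _ do rewrite hins.
  case: (top_last s); last first.
    under eq_bigr => p _ do rewrite andbF addn0.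
    by rewrite sumr_const card_ord mulr0 addr0 mulr_natl.
  rewrite (bigD1 (z m)) //= eqxx addn1 exprS.
  under eq_bigr => p hp do rewrite (negPf hp) addn0.
  rewrite sumr_const cardC1 card_ord /=.
  rewrite -[X in _ + X = _]mulr_natl -[m.+2%:R]natr1; ring.
elim: n => [|n IH].
  rewrite occ_poly1 // /occ_formula big_ord0 -[1`!]/1%N; ring.
(* The coefficients (n + 2) and (X - 2) add up to the new factor X + n. *)
rewrite hF mulrDr mulrCA IH hA /occ_formula big_ord_recr /= [in RHS]factS natrM.
rewrite -[n.+2]addn1 -[n.+1]addn1 !natrD; ring.
Qed.

Lemma occ_poly_pattern9 n : ('X - 2%:R) * occ_poly pattern9 n.+1 = occ_formula n.
Proof.
(* First place gives ['X], the [m] middle positions give 1 each, and last place resets each of the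
   (m + 1)! permutations to zero occurrences. *)
have hF m : occ_poly pattern9 m.+2
    = ('X + m%:R) * occ_poly pattern9 m.+1 + m.+1`!%:R.
  rewrite /occ_poly (sum_lift_perm ord0) mulr_sumr -card_Sn -sum1_card natr_sum.
  rewrite -big_split; apply: eq_bigr => s _ /=.
  under eq_bigr => p _ do rewrite occ_count_pattern9_insert.
  rewrite (bigD1 ord_max) //= eqxx expr0 addrC; congr (_ + _).
  rewrite (bigD1 ord0) //= addn1 exprS mulrDl; congr (_ + _).
  under eq_bigr => p /andP[h1 h2] do rewrite (negPf h1) (negPf h2) /= addn0.
  rewrite sumr_const mulr_natl; congr (_ *+ _).
  by rewrite -[RHS](@card_neq2 m ord_max ord0).
elim: n => [|n IH].
  rewrite occ_poly1 // /occ_formula big_ord0 -[1`!]/1%N; ring.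
rewrite hF mulrDr mulrCA IH /occ_formula big_ord_recr /= [in RHS]factS natrM.
rewrite -[n.+2]addn1 -[n.+1]addn1 !natrD; ring.
Qed.

(** * The sixteen patterns and their avoiders *)

Definition cell_images (l : seq (nat * nat)) :=
  [:: l; map swap_cell l; map rot_cell l; map swap_cell (map rot_cell l)].

Definition sixteen_cells :=
  flatten (map cell_images [:: pattern1; pattern5; pattern9; pattern13]).

(** The orbits list the cells in another order, so the lists are matched up to permutation, by a
    finite computation. *)
Lemma sixteen_shadingsP R :
  R \in sixteen_shadings -> exists2 l, l \in sixteen_cells & R = shading_of l.
Proof.
case/mapP => l hl ->; suff /hasP[l' hl' ll'] : has (perm_eq l) sixteen_cells.
  by exists l' => //; apply: shading_of_perm_eq.
by move: l hl; apply/(allP (a := fun l => has (perm_eq l) sixteen_cells)).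
Qed.

Lemma occ_poly_sixteen l n : l \in sixteen_cells ->
  ('X - 2%:R) * occ_poly l n.+1 = occ_formula n.
Proof.
have hv m : inord m != ord_max :> 'I_m.+2 by rewrite -val_eqE /= inordK //; lia.
have base b : b \in [:: pattern1; pattern5; pattern9; pattern13] ->
    in_grid b /\ ('X - 2%:R) * occ_poly b n.+1 = occ_formula n.
  rewrite !inE => /or4P[] /eqP ->; split=> //; last 2 first.
  - exact: occ_poly_pattern9.
  - exact: (occ_poly_top (v := fun m => inord m) (z := fun m => ord0)
      _ _ _ _ top_insertion_pattern13).
  - exact: (occ_poly_top (v := fun m => ord0) (z := fun m => ord0)
      _ _ _ _ top_insertion_pattern1).
  - exact: (occ_poly_top (v := fun m => ord0) (z := fun m => inord m)
      _ _ _ _ top_insertion_pattern5).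
case/flatten_mapP => b /base[hg <-]; rewrite !inE => /or4P[] /eqP -> //=.
- by rewrite occ_poly_swap.
- by rewrite occ_poly_rot.
- by rewrite occ_poly_swap ?in_grid_rot // occ_poly_rot.
Qed.

(** The non-zero factor ['X - 2] cancels in an integral domain. *)
Lemma occ_poly_sixteen_eq l1 l2 n : l1 \in sixteen_cells -> l2 \in sixteen_cells ->
  occ_poly l1 n.+1 = occ_poly l2 n.+1.
Proof.
move=> h1 h2; apply: (@mulfI _ ('X - 2%:R)).
  by rewrite -polyC_natr polyXsubC_eq0.
by rewrite !occ_poly_sixteen.
Qed.

Lemma num_perms_avoiding l n : l \in sixteen_cells ->
  (2 * num_perms_with_occ (shading_of l) n.+2 0 = n.+2`!)%N.
Proof.
move=> hl; have /(congr1 (fun p => p.[0])) := occ_poly_sixteen n.+1 hl.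
(* The product has [n.+1] factors, and the one for k = 0 is ['X], which vanishes at 0. *)
rewrite /occ_formula big_ord_recl !hornerE hornerMn hornerC /=.
rewrite (horner_coef0 (occ_poly _ _)).
rewrite coef_occ_poly ?mulr0 mul0r add0r mulNr => /oppr_inj.
by rewrite -[1 + 1]/(2%:R) -natrM => /eqP; rewrite eqr_nat => /eqP.
Qed.

(** * Size zero, avoidance and conclusion *)

(** The closed form starts at size 1, so equidistribution in size 0 is treated apart. *)
Lemma num_perms_with_occ0 R k : num_perms_with_occ R 0 k = (k == 0)%N.
Proof.
have h (s : 'S_0) : occ_count R s = 0%N.
  by apply/eqP; rewrite cards_eq0; apply/eqP/setP => -[[]].
rewrite /num_perms_with_occ; case: eqP => [->|/eqP hk].
  rewrite -[RHS](card_Sn 0) -cardsT; apply: eq_card => s.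
  by rewrite !inE h eqxx.
by apply: eq_card0 => s; rewrite inE h eq_sym (negPf hk).
Qed.

Lemma avoidsE R n (s : 'S_n) : avoids R s = (occ_count R s == 0)%N.
Proof.
rewrite /avoids /occ_count cards_eq0; apply/idP/eqP => [/existsPn h|h].
  by apply/setP => x; rewrite !inE; apply/negbTE/h.
by apply/existsPn => x; move/setP/(_ x): h; rewrite !inE => ->.
Qed.

Local Close Scope ring_scope.

Theorem theorem3p12 :
  (forall R1 R2 : shading, R1 \in sixteen_shadings -> R2 \in sixteen_shadings ->
     equidistributed R1 R2)
  /\ (forall R : shading, R \in sixteen_shadings ->
        forall n : nat, 2 <= n -> #|[set s : 'S_n | avoids R s]| = n`! %/ 2).
Proof.
split=> [R1 R2 /sixteen_shadingsP[l1 h1 ->] /sixteen_shadingsP[l2 h2 ->] [|n] k|].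
- by rewrite !num_perms_with_occ0.
- apply/eqP; rewrite -(eqr_nat int) -!coef_occ_poly.
  by rewrite (occ_poly_sixteen_eq _ h1 h2).
move=> R /sixteen_shadingsP[l hl ->] [|[|n]] // _.
rewrite -(num_perms_avoiding n hl) mulKn //.
by apply: eq_card => s; rewrite !inE avoidsE.
Qed.
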